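(* Let $\mathcal K=\mathcal K_1\times\cdots\times\mathcal K_J$ be a product of second-order cones $\mathcal K_i\subset\mathbb{R}^{m_i}$, $m=\sum_{i=1}^Jm_i$, let $\Lambda\subseteq\mathbb{R}^l$ be closed, and let $F:\mathbb{R}^n\to\mathbb{R}^l$, $G=(G_1,\dots,G_J),H=(H_1,\dots,H_J):\mathbb{R}^n\to\mathbb{R}^m$ be continuously differentiable with $G_i,H_i:\mathbb{R}^n\to\mathbb{R}^{m_i}$. Let $\mathcal F$ be the set of $z\in\mathbb{R}^n$ with $\mathcal K\ni G(z)\perp H(z)\in\mathcal K$ and $F(z)\in\Lambda$, and let $z^*\in\mathcal F$. If the NNAMCQ holds at $z^*$, that is, $$\left.\begin{array}{l}\nabla F(z^* )^T\lambda^F+\sum_{i=1}^J\{\nabla G_i(z^* )^T\lambda_i^G+\nabla H_i(z^* )^T\lambda_i^H\}=0,\\ \lambda^F\in N_\Lambda(F(z^* )),\ \ (\lambda^G,\lambda^H)\in N_\Omega(G(z^* ),H(z^* ))\end{array}\right\}\Longrightarrow(\lambda^F,\lambda^G,\lambda^H)=0,$$ then the system $\mathcal K\ni G(z)\perp H(z)\in\mathcal K$, $F(z)\in\Lambda$ has a local error bound at $z^*$.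
   Context: $\mathcal K_i=\{(x_1,x_2)\in\mathbb{R}\times\mathbb{R}^{m_i-1}:x_1\ge\|x_2\|\}$ ($=\mathbb{R}_+$ if $m_i=1$). $\Omega=\{(x,y)\in\mathbb{R}^m\times\mathbb{R}^m:\mathcal K\ni x\perp y\in\mathcal K\}$, $\Omega_i=\{(x,y)\in\mathbb{R}^{m_i}\times\mathbb{R}^{m_i}:\mathcal K_i\ni x\perp y\in\mathcal K_i\}$; $\lambda^G=(\lambda_1^G,\dots,\lambda_J^G)$, $\lambda^H=(\lambda_1^H,\dots,\lambda_J^H)$ with $\lambda_i^G,\lambda_i^H\in\mathbb{R}^{m_i}$. $\nabla$ denotes the Jacobian matrix; $d_C(z)=d(z,C)$ is Euclidean distance. The system has a local error bound at $z^*\in\mathcal F$ if there are $\kappa>0$ and a neighborhood $U$ of $z^*$ with $d(z,\mathcal F)\le\kappa\{d_\Lambda(F(z))+\sum_{i=1}^Jd_{\Omega_i}(G_i(z),H_i(z))\}$ for all $z\in U$. For $C\subseteq\mathbb{R}^n$, $z\in C$: regular normal cone $\widehat N_C(z)=\{v:\langle v,z'-z\rangle\le o(\|z'-z\|)\ \forall z'\in C\}$; limiting normal cone $N_C(z)=\{\lim v_k: v_k\in\widehat N_C(z_k),\ z_k\in C,\ z_k\to z\}$. *)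

(* Defs.v *)
From HB Require Import structures.
From mathcomp Require Import all_boot all_order all_algebra.
From mathcomp Require Import all_classical all_reals all_analysis.

Set Implicit Arguments.
Unset Strict Implicit.
Unset Printing Implicit Defensive.

Import Order.TTheory GRing.Theory Num.Theory.
Import numFieldNormedType.Exports.

Local Open Scope classical_set_scope.
Local Open Scope ring_scope.

(* Vectors of R^N are row vectors.  The library norm `|x| on 'rV[R]_N is the
   sup norm: it is used only through the topology and the differential, which
   agree with the Euclidean ones. *)
Section euclidean.
Variable R : realType.

Definition dot (N : nat) (u v : 'rV[R]_N) : R := \sum_(j < N) u 0 j * v 0 j.

Definition enorm (N : nat) (u : 'rV[R]_N) : R := Num.sqrt (dot u u).

(* Meaningful for nonempty C only: inf set0 = 0. *)
Definition dist (N : nat) (C : set 'rV[R]_N) (z : 'rV[R]_N) : R :=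
  inf [set enorm (z - c) | c in C].

Definition regular_normal (N : nat) (C : set 'rV[R]_N) (z : 'rV[R]_N) :
    set 'rV[R]_N :=
  [set v | forall e : R, 0 < e ->
    \forall z' \near z, C z' -> dot v (z' - z) <= e * enorm (z' - z)].

Definition limiting_normal (N : nat) (C : set 'rV[R]_N) (z : 'rV[R]_N) :
    set 'rV[R]_N :=
  [set v | exists zk vk : nat -> 'rV[R]_N,
    [/\ forall k, C (zk k),
        forall k, regular_normal C (zk k) (vk k),
        zk @ \oo --> z &
        vk @ \oo --> v]].

(* 'J f z acts on row vectors by v *m 'J f z = 'd f z v, so it is the transpose
   of the usual Jacobian matrix; continuity is unaffected. *)
Definition continuously_differentiable (N M : nat)
    (f : 'rV[R]_N -> 'rV[R]_M) : Prop :=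
  (forall z, differentiable f z) /\ continuous (fun z => 'J f z).

End euclidean.

Section cones.
Variable R : realType.

(* The second-order cone of R^(p + 1); x_2 is col' ord0 x, which is empty if
   p = 0. *)
Definition soc (p : nat) : set 'rV[R]_p.+1 :=
  [set x | enorm (col' ord0 x) <= x 0 ord0].

Definition soc_prod (J : nat) (p : 'I_J -> nat) :
    set 'rV[R]_(\sum_(i < J) (p i).+1) :=
  [set x | forall i, soc (submxrow x i)].

Definition complementary (N : nat) (K : set 'rV[R]_N) (x y : 'rV[R]_N) : Prop :=
  [/\ K x, K y & dot x y = 0].

(* The pair (x, y) is encoded as row_mx x y. *)
Definition Omega (N : nat) (K : set 'rV[R]_N) : set 'rV[R]_(N + N) :=
  [set w | complementary K (lsubmx w) (rsubmx w)].

End cones.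

Arguments soc R p : clear implicits.
Arguments soc_prod R {J} p.

Section soc_system.
Variables (R : realType) (n l J : nat) (p : 'I_J -> nat).
Variables (Lambda : set 'rV[R]_l) (F : 'rV[R]_n -> 'rV[R]_l).
Variables G H : forall i : 'I_J, 'rV[R]_n -> 'rV[R]_(p i).+1.

Definition feasible : set 'rV[R]_n :=
  [set z | complementary (soc_prod R p) (\mxrow_i G i z) (\mxrow_i H i z) /\
           Lambda (F z)].

(* With row vectors, nabla F(z)^T lambda reads lambda *m ('J F z)^T. *)
Definition NNAMCQ (zs : 'rV[R]_n) : Prop :=
  forall (lamF : 'rV[R]_l) (lamG lamH : forall i : 'I_J, 'rV[R]_(p i).+1),
    lamF *m ('J F zs)^T
      + \sum_(i < J) (lamG i *m ('J (G i) zs)^T + lamH i *m ('J (H i) zs)^T)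
      = 0 ->
    limiting_normal Lambda (F zs) lamF ->
    limiting_normal (Omega (soc_prod R p))
      (row_mx (\mxrow_i G i zs) (\mxrow_i H i zs))
      (row_mx (\mxrow_i lamG i) (\mxrow_i lamH i)) ->
    [/\ lamF = 0, forall i, lamG i = 0 & forall i, lamH i = 0].

Definition local_error_bound (zs : 'rV[R]_n) : Prop :=
  exists2 kappa : R, 0 < kappa &
    \forall z \near zs,
      dist feasible z <=
      kappa * (dist Lambda (F z)
               + \sum_(i < J) dist (Omega (soc R (p i)))
                                   (row_mx (G i z) (H i z))).

End soc_system.

(* Main.v *)
(* Encode the system as Phi(z) \in D with D = Lambda x Omega closed and
   Phi = (F, G, H).  If the error bound fails at rate k near zs, there is z
   near zs with k d_D(Phi z) < d(z, feasible).  A minimizer z' of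
   y |-> d_D(Phi y) + |y - z| / k over the ball centered at z through zs then
   satisfies |z' - z| < d(z, feasible) <= |z - zs|, so it is infeasible and
   interior to the ball.  Projecting Phi z' on D at w, the unit vector u along
   Phi z' - w is a regular normal to D at w, and stationarity of z' gives
   |nabla Phi(z')^T u| <= 1 / k.  A cluster point of these u as k grows is a
   unit vector of N_D(Phi zs) killed by nabla Phi(zs)^T, against NNAMCQ.
   Finally d_D is at most the sum of the distances to the factors, because the
   dot product is nonnegative on second-order cones, so that complementarity in
   the product cone splits into complementarity in each factor. *)
Require Import Defs.
From HB Require Import structures.
From mathcomp Require Import all_boot all_order all_algebra.
From mathcomp Require Import all_classical all_reals all_analysis.
From mathcomp Require Import ring lra.
Import Order.TTheory GRing.Theory Num.Theory.
Import numFieldNormedType.Exports.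
Local Open Scope classical_set_scope.
Local Open Scope ring_scope.

(** * Limits of matrix-valued functions, entry by entry *)

Section matrix_convergence.
Set Implicit Arguments.
Unset Strict Implicit.
Variable R : numFieldType.
Variables (T : Type) (F : set_system T).
Context {FF : Filter F}.

Lemma cvg_bigsum (V : normedModType R) (I : Type) (r : seq I) (P : pred I)
    (f : I -> T -> V) (l : I -> V) :
  (forall i, P i -> f i @ F --> l i) ->
  \sum_(i <- r | P i) f i x @[x --> F] --> \sum_(i <- r | P i) l i.
Proof.
move=> fl; elim: r => [|i r IHr].
  by under eq_fun do rewrite big_nil; rewrite big_nil; exact: cvg_cst.
under eq_fun do rewrite big_cons; rewrite big_cons; case: ifPn => // Pi.
by apply: cvgD IHr; exact: fl.
Qed.

Lemma cvg_coord m n (f : T -> 'M[R]_(m, n)) (A : 'M[R]_(m, n)) i j :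
  f @ F --> A -> f x i j @[x --> F] --> A i j.
Proof.
move=> fA; apply: (@cvg_comp _ _ _ f (fun M : 'M[R]_(m, n) => M i j)).
  exact: fA.
exact: coord_continuous.
Qed.

(** A neighborhood of a matrix contains a product of neighborhoods of its finitely many entries, and
    a filter is stable under finite intersections. *)
Lemma cvg_mx m n (f : T -> 'M[R]_(m, n)) (A : 'M[R]_(m, n)) :
  (forall i j, f x i j @[x --> F] --> A i j) -> f @ F --> A.
Proof.
move=> fA P [Q AQ QP]; suff : \forall x \near F, forall i j, Q i j (f x i j).
  by apply: filterS => x Qx; exact: QP.
by do 2![apply: filter_forall => ?]; exact/fA/AQ.
Qed.

Lemma cvg_mulmx m n p (f : T -> 'M[R]_(m, n)) (g : T -> 'M[R]_(n, p))
    (A : 'M[R]_(m, n)) (B : 'M[R]_(n, p)) :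
  f @ F --> A -> g @ F --> B -> f x *m g x @[x --> F] --> A *m B.
Proof.
move=> fA gB; apply: cvg_mx => i j; under eq_fun do rewrite mxE.
by rewrite mxE; apply: cvg_bigsum => k _; apply: cvgM; exact: cvg_coord.
Qed.

Lemma cvg_trmx m n (f : T -> 'M[R]_(m, n)) (A : 'M[R]_(m, n)) :
  f @ F --> A -> (f x)^T @[x --> F] --> A^T.
Proof.
move=> fA; apply: cvg_mx => i j; under eq_fun do rewrite mxE.
by rewrite mxE; exact: cvg_coord.
Qed.

End matrix_convergence.

(** * Euclidean inner product and norm, compared with the topology of the sup norm *)

Section euclidean_norm.
Set Implicit Arguments.
Unset Strict Implicit.
Variable R : realType.
Implicit Types N M : nat.

Lemma dot_mulmx N (u v : 'rV[R]_N) : dot u v = (u *m v^T) 0 0.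
Proof. by rewrite mxE; apply: eq_bigr => j _; rewrite mxE. Qed.

Lemma dotC N (u v : 'rV[R]_N) : dot u v = dot v u.
Proof. by apply: eq_bigr => j _; rewrite mulrC. Qed.

Lemma dotDl N (u v w : 'rV[R]_N) : dot (u + v) w = dot u w + dot v w.
Proof. by rewrite !dot_mulmx mulmxDl mxE. Qed.

Lemma dotZl N a (u v : 'rV[R]_N) : dot (a *: u) v = a * dot u v.
Proof. by rewrite !dot_mulmx -scalemxAl mxE. Qed.

Lemma dotNl N (u v : 'rV[R]_N) : dot (- u) v = - dot u v.
Proof. by rewrite -scaleN1r dotZl mulN1r. Qed.

Lemma dotDr N (u v w : 'rV[R]_N) : dot w (u + v) = dot w u + dot w v.
Proof. by rewrite dotC dotDl !(dotC w). Qed.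

Lemma dotZr N a (u v : 'rV[R]_N) : dot u (a *: v) = a * dot u v.
Proof. by rewrite dotC dotZl dotC. Qed.

Lemma dotNr N (u v : 'rV[R]_N) : dot u (- v) = - dot u v.
Proof. by rewrite dotC dotNl dotC. Qed.

Lemma dot0r N (u : 'rV[R]_N) : dot u 0 = 0.
Proof. by rewrite -(scale0r 0) dotZr mul0r. Qed.

Lemma dot_sqrD N (u v : 'rV[R]_N) :
  dot (u + v) (u + v) = dot u u + 2 * dot u v + dot v v.
Proof. by rewrite !(dotDl, dotDr) (dotC v u); ring. Qed.

Lemma dot_mulmxr N M (u : 'rV[R]_M) (v : 'rV[R]_N) (A : 'M[R]_(N, M)) :
  dot u (v *m A) = dot (u *m A^T) v.
Proof. by rewrite !dot_mulmx trmx_mul mulmxA. Qed.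

Lemma dot_row_mx N M (a c : 'rV[R]_N) (b d : 'rV[R]_M) :
  dot (row_mx a b) (row_mx c d) = dot a c + dot b d.
Proof. by rewrite !dot_mulmx tr_row_mx mul_row_col mxE. Qed.

Lemma dot_mxrow J (q : 'I_J -> nat) (a b : forall i, 'rV[R]_(q i)) :
  dot (\mxrow_i a i) (\mxrow_i b i) = \sum_i dot (a i) (b i).
Proof.
rewrite dot_mulmx tr_mxrow mul_mxrow_mxcol summxE.
by apply: eq_bigr => i _; rewrite dot_mulmx.
Qed.

Lemma dot_ge0 N (u : 'rV[R]_N) : 0 <= dot u u.
Proof. by apply: sumr_ge0 => j _; rewrite -expr2 sqr_ge0. Qed.

Lemma enorm_ge0 N (u : 'rV[R]_N) : 0 <= enorm u.
Proof. exact: sqrtr_ge0. Qed.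

Lemma sqr_enorm N (u : 'rV[R]_N) : enorm u ^+ 2 = dot u u.
Proof. by rewrite sqr_sqrtr ?dot_ge0. Qed.

(** Each squared entry is one term of the sum of squares. This places Euclidean balls inside
    sup-norm balls, so that they can serve as neighborhoods. *)
Lemma normr_le_enorm N (u : 'rV[R]_N) : `|u| <= enorm u.
Proof.
rewrite [leLHS](mx_normrE u); apply/bigmax_leP; split=> [|[i j] _] /=.
  exact: enorm_ge0.
rewrite (ord1 i) -(ler_pXn2r (n := 2))// ?nnegrE ?enorm_ge0// sqr_enorm.
rewrite real_normK ?num_real// /dot (bigD1 j)//= -expr2 lerDl.
by apply: sumr_ge0 => k _; rewrite -expr2 sqr_ge0.
Qed.

Lemma enorm0 N : enorm (0 : 'rV[R]_N) = 0.
Proof. by rewrite /enorm dot0r sqrtr0. Qed.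

Lemma enorm_eq0 N (u : 'rV[R]_N) : enorm u = 0 -> u = 0.
Proof.
by move=> u0; apply/eqP; rewrite -normr_le0 -u0 normr_le_enorm.
Qed.

Lemma enormZ N a (u : 'rV[R]_N) : enorm (a *: u) = `|a| * enorm u.
Proof.
by rewrite /enorm dotZl dotZr mulrA -expr2 sqrtrM ?sqr_ge0// sqrtr_sqr.
Qed.

Lemma enormN N (u : 'rV[R]_N) : enorm (- u) = enorm u.
Proof. by rewrite /enorm dotNl dotNr opprK. Qed.

Lemma enormB N (u v : 'rV[R]_N) : enorm (u - v) = enorm (v - u).
Proof. by rewrite -enormN opprB. Qed.

Lemma cauchy_schwarz N (u v : 'rV[R]_N) : dot u v <= enorm u * enorm v.
Proof.
have [u0|u0] := eqVneq (enorm u) 0.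
  by rewrite (enorm_eq0 u0) dotC dot0r enorm0 mul0r.
have [v0|v0] := eqVneq (enorm v) 0.
  by rewrite (enorm_eq0 v0) dot0r enorm0 mulr0.
have uv0 : 0 < enorm u * enorm v by rewrite mulr_gt0// lt0r enorm_ge0 ?u0 ?v0.
rewrite -subr_ge0 -(pmulr_rge0 _ uv0).
(* This square expands to [2 |u| |v| (|u| |v| - dot u v)], where [|u| |v|] is positive. *)
have := dot_ge0 (enorm v *: u - enorm u *: v).
rewrite !(dotDl, dotDr, dotNl, dotNr, dotZl, dotZr) -!sqr_enorm (dotC v u).
lra.
Qed.

Lemma enormD N (u v : 'rV[R]_N) : enorm (u + v) <= enorm u + enorm v.
Proof.
rewrite -(ler_pXn2r (n := 2))// ?nnegrE ?addr_ge0 ?enorm_ge0//.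
rewrite sqr_enorm !(dotDl, dotDr) (dotC v u) -!sqr_enorm.
by have := cauchy_schwarz u v; lra.
Qed.

Lemma cvg_dot N (T : Type) (F : set_system T) {FF : Filter F}
    (f g : T -> 'rV[R]_N) (a b : 'rV[R]_N) :
  f @ F --> a -> g @ F --> b -> dot (f x) (g x) @[x --> F] --> dot a b.
Proof.
move=> fa gb; rewrite /dot; apply: cvg_bigsum => j _.
by apply: cvgM; exact: cvg_coord.
Qed.

Lemma cvg_enorm N (T : Type) (F : set_system T) {FF : Filter F}
    (f : T -> 'rV[R]_N) (a : 'rV[R]_N) :
  f @ F --> a -> enorm (f x) @[x --> F] --> enorm a.
Proof.
move=> fa; apply: (@cvg_comp _ _ _ (fun x => dot (f x) (f x)) Num.sqrt).
  exact: (cvg_dot fa fa).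
exact: sqrt_continuous.
Qed.

Lemma cvg_enormB N (z a : 'rV[R]_N) :
  enorm (y - a) @[y --> z] --> enorm (z - a).
Proof. exact: (cvg_enorm (cvgB cvg_id (cvg_cst a))). Qed.

Lemma near_enorm N (z : 'rV[R]_N) (e : R) : 0 < e ->
  \forall z' \near z, enorm (z' - z) < e.
Proof.
move=> e0; have /cvgr_lt := @cvg_enormB _ z z.
by rewrite subrr enorm0 => /(_ _ e0).
Qed.

(** Together with [near_enorm], this makes Euclidean balls a neighborhood base. *)
Lemma enorm_near N (z : 'rV[R]_N) (P : set 'rV[R]_N) : nbhs z P ->
  exists2 e, 0 < e & forall z', enorm (z' - z) < e -> P z'.
Proof.
move=> /nbhs_ballP[e e0 eP]; exists e => // z' zz'; apply: eP.
rewrite -ball_normE /=.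
by rewrite distrC (le_lt_trans (normr_le_enorm _)).
Qed.

Lemma cvg_enorm_natSinv N (u : nat -> 'rV[R]_N) (z : 'rV[R]_N) :
  (forall k, enorm (u k - z) <= k.+1%:R^-1) -> u @ \oo --> z.
Proof.
move=> uz P /enorm_near[e e0 eP]; suff: \forall k \near \oo, P (u k) by [].
near=> k; apply: eP; rewrite (le_lt_trans (uz k))//.
by near: k; exact: near_infty_natSinv_lt (PosNum e0).
Unshelve. all: by end_near. Qed.

Lemma compact_eball N (z : 'rV[R]_N) (r : R) :
  compact [set y | enorm (y - z) <= r].
Proof.
apply: bounded_closed_compact.
  exists (r + `|z|); split=> [|M /ltW rM y /= yr]; first exact: num_real.
  apply: le_trans rM; rewrite -lerBlDr (le_trans (lerB_dist y z))//.
  exact: le_trans (normr_le_enorm _) yr.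
rewrite (_ : [set _ | _] = (fun y => enorm (y - z)) @^-1` [set x | x <= r])//.
apply: preimage_closed => [y _|]; last exact: closed_le.
exact: cvg_enormB.
Qed.

End euclidean_norm.

(** * Distance to a closed set, projections and first-order conditions *)

Section distance_and_normals.
Set Implicit Arguments.
Unset Strict Implicit.
Variable R : realType.
Implicit Types N M : nat.

Lemma dist_le N (C : set 'rV[R]_N) z c : C c -> dist C z <= enorm (z - c).
Proof.
move=> Cc; apply: ge_inf; last by exists c.
by exists 0 => _ [y _ <-]; exact: enorm_ge0.
Qed.

Lemma dist_attained N (C : set 'rV[R]_N) z : closed C -> C !=set0 ->
  exists2 c, C c & dist C z = enorm (z - c).
Proof.
move=> Ccl [c0 Cc0].
(* Points of [C] farther from [z] than [c0] cannot compete, so the infimum is taken over a compact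
   piece of [C]. *)
pose B := [set y | enorm (y - z) <= enorm (c0 - z)] `&` C.
have Bc0 : B c0 by split=> //=.
have cB : compact B by exact: compact_closedI (@compact_eball _ _ z _) Ccl.
have [||c cB' cmin] := EVT_min_rV (f := fun y => enorm (y - z)) _ cB.
- by exists c0.
- by apply: continuous_subspaceT => y; exact: cvg_enormB.
have /= [_ Cc] := set_mem cB'; exists c => //.
apply/eqP; rewrite eq_le dist_le//= enormB.
apply: lb_le_inf; first by exists (enorm (z - c0)), c0.
move=> _ [y Cy <-]; rewrite (enormB z y).
have [yc0|/ltW c0y] := leP (enorm (y - z)) (enorm (c0 - z)).
  by apply: cmin; apply/mem_set.
by apply: le_trans c0y; apply: cmin; exact/mem_set.
Qed.

Lemma dist_lipschitz N (C : set 'rV[R]_N) x y : closed C -> C !=set0 ->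
  dist C x <= dist C y + enorm (x - y).
Proof.
move=> Ccl /(dist_attained y Ccl)[c Cc ->].
rewrite (le_trans (dist_le _ Cc))// -(subrKA y x (- c)) [leRHS]addrC.
exact: enormD.
Qed.

Lemma dist_continuous N (C : set 'rV[R]_N) : closed C -> C !=set0 ->
  continuous (dist C).
Proof.
move=> Ccl C0 x; apply/(@cvgrPdist_lt _ _ _ (nbhs x)) => e e0.
near=> y.
have yx : enorm (y - x) < e by near: y; exact: near_enorm.
rewrite ltr_norml.
have := dist_lipschitz x y Ccl C0; have := dist_lipschitz y x Ccl C0.
rewrite (enormB x y); lra.
Unshelve. all: by end_near. Qed.

(** Proximal normals are regular: squaring [|y - w| <= |y - c|] bounds [2 dot (y - w) (c - w)] by
    [|c - w|^2], which is [o(|c - w|)]. *)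
Lemma projection_regular_normal N (C : set 'rV[R]_N) y w t : 0 <= t ->
  (forall c, C c -> enorm (y - w) <= enorm (y - c)) ->
  regular_normal C w (t *: (y - w)).
Proof.
move=> t0 wmin e e0; near=> c => Cc.
(* The denominator [t + 1] stays positive when [t = 0] and still gives [t |c - w| <= e]. *)
have cw : enorm (c - w) < e / (t + 1).
  by near: c; apply: near_enorm; rewrite divr_gt0// ltr_wpDl.
have tcw : t * enorm (c - w) <= e.
  rewrite ltr_pdivlMr ?ltr_wpDl// in cw.
  by have := enorm_ge0 (c - w); lra.
have {}wmin : 2 * dot (y - w) (c - w) <= enorm (c - w) ^+ 2.
  have := wmin _ Cc; rewrite -(ler_pXn2r (n := 2))// ?nnegrE ?enorm_ge0//.
  rewrite -(subrKA w y (- c)) -(opprB c w) !sqr_enorm.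
  rewrite !(dotDl, dotDr, dotNl, dotNr) -?(dotC c) -?(dotC w).
  lra.
rewrite dotZl; apply: (@le_trans _ _ (t * enorm (c - w) ^+ 2)).
  by apply: ler_wpM2l => //; have := sqr_ge0 (enorm (c - w)); lra.
by rewrite expr2 mulrA ler_wpM2r ?enorm_ge0.
Unshelve. all: by end_near. Qed.

(** At a local minimum of [|f y - w| + c |y - z|] all one-sided directional derivatives are
    nonnegative. Working with squares avoids differentiating the norm. *)
Lemma stationary_distance n N (f : 'rV[R]_n -> 'rV[R]_N) z w c :
  differentiable f z -> 0 <= c ->
  (\forall y \near z,
    enorm (f z - w) <= enorm (f y - w) + c * enorm (y - z)) ->
  enorm ((f z - w) *m ('J f z)^T) <= c * enorm (f z - w).
Proof.
move=> df c0 zmin; set q := f z - w; set p := q *m _.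
suff key v : 0 <= dot q (v *m 'J f z) + c * enorm q * enorm v.
  (* In the steepest descent direction [- p] the inequality reads [|p|^2 <= c |q| |p|]. *)
  have := key (- p); rewrite dot_mulmxr -/p dotNr enormN -sqr_enorm.
  have [->|p0] := eqVneq (enorm p) 0; first by rewrite mulr_ge0 ?enorm_ge0.
  by rewrite addrC subr_ge0 expr2 ler_pM2r// lt0r p0 enorm_ge0.
pose s (h : R) := h^-1 *: (f (h *: v + z) - f z).
have sv : s h @[h --> 0^'+] --> v *m 'J f z.
  apply: cvg_dnbhs_at_right; rewrite -deriveEjacobian//.
  exact: (diff_derivable df).
(* psi h >= 0 is the square of the inequality of zmin at h *: v + z, divided
   by h > 0. *)
pose psi (h : R) := 2 * dot q (s h) + h * dot (s h) (s h)
  + 2 * c * enorm v * enorm (q + h *: s h) + c ^+ 2 * h * enorm v ^+ 2.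
have h0 : (h : R) @[h --> 0^'+] --> (0 : R).
  exact: cvg_at_right_filter cvg_id.
(* The limit is left in the shape produced by the limit rules; its terms with a factor 0 are removed
   afterwards. *)
have psiv : psi h @[h --> 0^'+] -->
    2 * dot q (v *m 'J f z) + 0 * dot (v *m 'J f z) (v *m 'J f z)
    + 2 * c * enorm v * enorm (q + 0 *: (v *m 'J f z))
    + c ^+ 2 * 0 * enorm v ^+ 2.
  apply: cvgD; last first.
    by apply: cvgM; [apply: cvgM => //; exact: cvg_cst|exact: cvg_cst].
  apply: cvgD; last first.
    apply: cvgM; first exact: cvg_cst.
    exact: (cvg_enorm (cvgD (cvg_cst _) (cvgZ h0 sv))).
  apply: cvgD; last by apply: cvgM => //; exact: (cvg_dot sv sv).
  by apply: cvgM; [exact: cvg_cst|exact: (cvg_dot (cvg_cst _) sv)].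
suff : 0 <= 2 * dot q (v *m 'J f z) + 0 * dot (v *m 'J f z) (v *m 'J f z)
    + 2 * c * enorm v * enorm (q + 0 *: (v *m 'J f z))
    + c ^+ 2 * 0 * enorm v ^+ 2.
  by rewrite scale0r addr0; lra.
refine (@closed_cvg _ _ _ _ psi _ (@closed_ge R 0) _ _ psiv).
have hz : h *: v + z @[h --> 0^'+] --> z.
  rewrite -[X in _ --> X]add0r -(scale0r v).
  exact: (cvgD (cvgZ h0 (cvg_cst v)) (cvg_cst z)).
near=> h.
have h_gt0 : 0 < h by near: h; exact: nbhs_right_gt.
have : enorm q <= enorm (f (h *: v + z) - w) + c * enorm (h *: v + z - z).
  by near: h; exact: (hz _ zmin).
rewrite addrK enormZ gtr0_norm//.
have -> : f (h *: v + z) - w = q + h *: s h.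
  by rewrite scalerA divff ?gt_eqF// scale1r [RHS]addrC subrKA.
have rhs0 : 0 <= enorm (q + h *: s h) + c * (h * enorm v).
  by rewrite addr_ge0 ?enorm_ge0// mulr_ge0// mulr_ge0 ?enorm_ge0// ltW.
rewrite -(ler_pXn2r (n := 2))// ?nnegrE ?enorm_ge0//.
rewrite sqrrD (sqr_enorm (q + _)) (sqr_enorm q) (dot_sqrD q) !(dotZr h) dotZl.
move=> hmin; rewrite /= -(pmulr_rge0 _ h_gt0) /psi; lra.
Unshelve. all: by end_near. Qed.

End distance_and_normals.

(** * Error bound for a single inclusion [Phi z \in D] under a normal-cone qualification *)

Section constraint_qualification.
Set Implicit Arguments.
Unset Strict Implicit.
Variables (R : realType) (n N : nat).
Variables (D : set 'rV[R]_N) (Phi : 'rV[R]_n -> 'rV[R]_N) (zs : 'rV[R]_n).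
Hypotheses (D_closed : closed D) (Phi_C1 : continuously_differentiable Phi).
Hypothesis zs_sol : D (Phi zs).

(** The bound on [Phi z' - w] will force [w] to tend to [Phi zs] along with [Phi z'], and the unit
    norm will keep the limit of the normals nonzero. *)
Lemma almost_stationary_normal z k : 0 < k ->
  k * dist D (Phi z) < dist (Phi @^-1` D) z ->
  exists zwu : 'rV[R]_n * 'rV[R]_N * 'rV[R]_N, let: (z', w, u) := zwu in
  [/\ enorm (z' - z) <= enorm (z - zs),
      D w /\ enorm (Phi z' - w) <= enorm (Phi z' - Phi zs),
      regular_normal D w u, enorm u = 1 &
      enorm (u *m ('J Phi z')^T) <= k^-1].
Proof.
move=> k0 kz; have [Phi_diff _] := Phi_C1.
have D0 : D !=set0 by exists (Phi zs).
pose g y := dist D (Phi y) + k^-1 * enorm (y - z).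
have gc (y : 'rV[R]_n) : g y' @[y' --> y] --> g y.
  have Phic := differentiable_continuous (Phi_diff y).
  have dc : dist D (Phi y') @[y' --> y] --> dist D (Phi y).
    exact: (continuous_comp Phic (@dist_continuous _ _ _ D_closed D0 (Phi y))).
  exact: (cvgD dc (cvgM (cvg_cst k^-1) (@cvg_enormB _ _ y z))).
have zsB : [set y | enorm (y - z) <= enorm (z - zs)] z.
  by rewrite /= subrr enorm0 enorm_ge0.
have [||z' /set_mem/= z'B z'min] :=
  EVT_min_rV (f := g) _ (compact_eball (z := z) (r := enorm (z - zs))).
- by exists z.
- exact: continuous_subspaceT.
(* Minimality against [z] gives [k^-1 |z' - z| <= g z' <= g z = dist D (Phi z)]. *)
have z'z : enorm (z' - z) < dist (Phi @^-1` D) z.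
  apply: le_lt_trans kz; have := z'min z (mem_set zsB).
  rewrite /g subrr enorm0 mulr0 addr0 -ler_pdivrMl//.
  apply: le_trans; rewrite lerDr.
  by have [c _ ->] := dist_attained (Phi z') D_closed D0; exact: enorm_ge0.
have z'D : ~ D (Phi z').
  move=> z'D; have := dist_le z (C := Phi @^-1` D) z'D.
  by rewrite enormB leNgt z'z.
have [w Dw wE] := dist_attained (Phi z') D_closed D0.
set q := Phi z' - w in wE *.
have q0 : 0 < enorm q.
  rewrite lt0r enorm_ge0 andbT; apply/eqP => /enorm_eq0/eqP.
  by rewrite subr_eq0 => /eqP z'w; apply: z'D; rewrite z'w.
have stat : enorm (q *m ('J Phi z')^T) <= k^-1 * enorm q.
  apply: stationary_distance => //; first by rewrite invr_ge0 ltW.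
  (* Since [zs] is feasible, [z'] lies strictly inside the ball, so every [y] near [z'] competes
     with it. *)
  have /cvgr_lt/(_ (enorm (z - zs))) := @cvg_enormB _ _ z' z.
  have -> : enorm (z' - z) < enorm (z - zs).
    by apply: lt_le_trans z'z _; exact: dist_le.
  move=> /(_ isT); apply: filterS => y /ltW yB.
  (* The projection [w] is frozen: [|Phi y - w|] dominates the distance to [D], with equality at
     [z']. The triangle inequality moves the center of the penalty from [z] to [z']. *)
  have := z'min y (mem_set yB); rewrite /g wE -/q.
  have : k^-1 * enorm (y - z) <= k^-1 * (enorm (y - z') + enorm (z' - z)).
    apply: ler_wpM2l; first by rewrite invr_ge0 ltW.
    by rewrite -(subrKA z' y (- z)) enormD.
  by have := dist_le (Phi y) Dw; lra.
exists (z', w, (enorm q)^-1 *: q); split => //.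
- by split => //; rewrite -/q -wE; exact: dist_le.
- apply: projection_regular_normal; first by rewrite invr_ge0 enorm_ge0.
  by move=> c Dc; rewrite -/q -wE; exact: dist_le.
- by rewrite enormZ gtr0_norm ?invr_gt0// mulVf ?gt_eqF.
- rewrite -scalemxAl enormZ gtr0_norm ?invr_gt0// mulrC.
  by rewrite ler_pdivrMr.
Qed.

Lemma error_bound_of_qualification :
  (forall u, u *m ('J Phi zs)^T = 0 -> limiting_normal D (Phi zs) u -> u = 0) ->
  exists2 kappa, 0 < kappa &
    \forall z \near zs, dist (Phi @^-1` D) z <= kappa * dist D (Phi z).
Proof.
move=> qual; apply: contrapT => no_bound; have [Phi_diff JPhi_cont] := Phi_C1.
have /choice[x xP] (k : nat) : exists zwu : 'rV[R]_n * 'rV[R]_N * 'rV[R]_N,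
    let: (z', w, u) := zwu in
    [/\ enorm (z' - zs) <= k.+1%:R^-1,
      D w /\ enorm (Phi z' - w) <= enorm (Phi z' - Phi zs),
      regular_normal D w u, enorm u = 1 &
      enorm (u *m ('J Phi z')^T) <= k.+1%:R^-1].
  (* If no such [z] existed, [k.+1] would be an error bound constant. The radius is halved because
     [|z' - zs| <= |z' - z| + |z - zs| <= 2 |z - zs|]. *)
  have [z [zzs zk]] : exists z, enorm (z - zs) < (2 * k.+1%:R)^-1 /\
      k.+1%:R * dist D (Phi z) < dist (Phi @^-1` D) z.
    apply: contrapT => noz; apply: no_bound; exists k.+1%:R => //.
    have := near_enorm zs (e := (2 * k.+1%:R)^-1).
    rewrite invr_gt0 mulr_gt0// => /(_ isT); apply: filterS => z zzs.
    by rewrite leNgt; apply/negP => zk; apply: noz; exists z.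
  have [[[z' w] u] [z'z *]] := almost_stationary_normal (ltr0Sn _ k) zk.
  exists (z', w, u); split=> //.
  rewrite -(subrKA z z' (- zs)) (le_trans (enormD _ _))//.
  by move: zzs z'z; rewrite invfM; move: (_.+1%:R^-1) => t; lra.
pose z k := (x k).1.1; pose w k := (x k).1.2; pose u k := (x k).2.
have {}xP k : [/\ enorm (z k - zs) <= k.+1%:R^-1,
      D (w k) /\ enorm (Phi (z k) - w k) <= enorm (Phi (z k) - Phi zs),
      regular_normal D (w k) (u k), enorm (u k) = 1 &
      enorm (u k *m ('J Phi (z k))^T) <= k.+1%:R^-1].
  by have := xP k; rewrite /z /w /u; case: (x k) => -[].
have z_lim : z @ \oo --> zs by apply: cvg_enorm_natSinv => k; have [] := xP k.
(* The unit normals stay in a compact ball, hence have a cluster point. *)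
have [u0 [_ u0_clus]] :
    [set v : 'rV[R]_N | enorm (v - 0) <= 1] `&` cluster (u @ \oo) !=set0.
  apply: compact_eball; exists 0%N => // k _ /=.
  by rewrite subr0; have [_ _ _ ->] := xP k.
(* Extraction of a subsequence: [h] need not be increasing, since [j <= h j] already sends it to
   infinity. *)
have /choice[h hP] (j : nat) : exists k,
    (j <= k)%N /\ enorm (u k - u0) <= j.+1%:R^-1.
  have [||_ [[k jk <-] uk]] := u0_clus (u @` [set k | (j <= k)%N])
    [set v | enorm (v - u0) < j.+1%:R^-1].
  - by exists j => // k jk; exists k.
  - exact: near_enorm.
  by exists k; split => //; exact: ltW.
have h_lim : h @ \oo --> \oo.
  move=> P [j _ jP]; exists j => // k jk; apply: jP => /=.
  by apply: leq_trans jk _; have [] := hP k.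
have uh_lim : u \o h @ \oo --> u0.
  by apply: cvg_enorm_natSinv => k; have [] := hP k.
have zh_lim : z \o h @ \oo --> zs by exact: (cvg_comp _ _ h_lim z_lim).
have Phizh_lim : Phi \o z \o h @ \oo --> Phi zs.
  exact: (cvg_comp _ _ zh_lim (differentiable_continuous (Phi_diff zs))).
have u0_unit : enorm u0 = 1.
  refine (@closed_cvg _ _ _ _ _ _ (@closed_eq R 1) _ _ (cvg_enorm uh_lim)).
  by near=> k; have [] := xP (h k).
have u0_normal : limiting_normal D (Phi zs) u0.
  exists (w \o h), (u \o h); split => //.
  - by move=> k; have [_ []] := xP (h k).
  - by move=> k; have [] := xP (h k).
  (* [w (h k)] is no farther from [Phi (z (h k))] than [Phi zs] is, so each of the two distances
     takes half of [e]. *)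
  move=> P /enorm_near[e e0 eP]; suff : \forall k \near \oo, P (w (h k)) by [].
  have : \forall k \near \oo, enorm (Phi (z (h k)) - Phi zs) < e / 2.
    have e2 : 0 < e / 2 by rewrite divr_gt0.
    exact: (Phizh_lim _ (near_enorm (Phi zs) e2)).
  apply: filterS => k Phie; apply: eP; have [_ [_ wPhi] _ _ _] := xP (h k).
  rewrite -(subrKA (Phi (z (h k)))) (le_lt_trans (enormD _ _))// enormB; lra.
have u0_ker : u0 *m ('J Phi zs)^T = 0.
  have lim : enorm ((u (h k)) *m ('J Phi (z (h k)))^T) @[k --> \oo] -->
      enorm (u0 *m ('J Phi zs)^T).
    have J_lim : 'J Phi (z (h k)) @[k --> \oo] --> 'J Phi zs.
      exact: (cvg_comp _ _ zh_lim (JPhi_cont zs)).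
    exact: (cvg_enorm (cvg_mulmx uh_lim (cvg_trmx J_lim))).
  apply: enorm_eq0; apply/eqP; rewrite eq_le enorm_ge0 andbT.
  (* The norms are at most [(h k).+1^-1 <= k.+1^-1], so their limit is below every positive [e]. *)
  apply/ler_addgt0Pl => e e0; rewrite addr0.
  refine (@closed_cvg _ _ _ _ _ _ (@closed_le R e) _ _ lim).
  near=> k => /=; have [_ _ _ _ /le_trans->//] := xP (h k).
  have ke : k.+1%:R^-1 < e by near: k; exact: near_infty_natSinv_lt (PosNum e0).
  apply: le_trans (ltW ke); rewrite lef_pV2 ?posrE// ler_nat ltnS.
  by have [] := hP k.
move: u0_unit; rewrite (qual _ u0_ker u0_normal) enorm0 => /eqP.
by rewrite eq_sym oner_eq0.
Unshelve. all: by end_near. Qed.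

End constraint_qualification.

(** * Jacobians of concatenated maps *)

Section block_jacobian.
Set Implicit Arguments.
Unset Strict Implicit.
Variables (R : realType) (n : nat).
Implicit Types (z : 'rV[R]_n) (m : nat).

Lemma is_diff_jacobian m (f : 'rV[R]_n -> 'rV[R]_m) z :
  differentiable f z -> is_diff z f (fun v => v *m 'J f z).
Proof.
by move=> df; apply: DiffDef => //; apply/funext => v; rewrite mul_rV_lin1.
Qed.

(** The differential is unique, and its value at the [i]-th basis vector is row [i] of either
    matrix. *)
Lemma jacobian_is_diff m (f : 'rV[R]_n -> 'rV[R]_m) z (A : 'M[R]_(n, m)) :
  is_diff z f (fun v => v *m A) -> 'J f z = A.
Proof.
move=> df; apply/row_matrixP => i; rewrite !rowE /jacobian mul_rV_lin1.
by rewrite diff_val.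
Qed.

Lemma mulmxr_continuous m k (A : 'M[R]_(m, k)) :
  continuous (mulmxr A : 'rV[R]_m -> 'rV[R]_k).
Proof.
suff h (x : 'rV[R]_m) : y *m A @[y --> x] --> x *m A by exact: h.
have idx : (fun y : 'rV[R]_m => y) @ x --> x by exact: cvg_id.
have cstA : (fun=> A : 'M[R]_(m, k)) @ nbhs x --> A by exact: cvg_cst.
exact: (cvg_mulmx idx cstA).
Qed.

Lemma is_diff_mulmxr m k (f : 'rV[R]_n -> 'rV[R]_m) df z (A : 'M[R]_(m, k)) :
  is_diff z f df -> is_diff z (fun y => f y *m A) (fun v => df v *m A).
Proof.
move=> fdf; have Ac := @mulmxr_continuous _ _ A.
have dA : is_diff (f z) (mulmxr A : 'rV[R]_m -> 'rV[R]_k) (mulmxr A).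
  by apply: DiffDef; [exact: linear_differentiable|rewrite diff_lin].
exact: (@is_diff_comp _ _ _ _ f df (mulmxr A) (mulmxr A) z fdf dA).
Qed.

Lemma is_diff_bigsum m J (f df : 'I_J -> 'rV[R]_n -> 'rV[R]_m) z :
  (forall i, is_diff z (f i) (df i)) ->
  is_diff z (fun y => \sum_i f i y) (fun v => \sum_i df i v).
Proof.
move=> fdf; elim: (index_enum _) => [|i r IHr].
  have E (g : 'I_J -> 'rV[R]_n -> 'rV[R]_m) :
      (fun y => \sum_(j <- [::]) g j y) = cst 0.
    by apply/funext => y; rewrite big_nil.
  by rewrite !E; exact: is_diff_cst.
have E (g : 'I_J -> 'rV[R]_n -> 'rV[R]_m) :
    (fun y => \sum_(j <- i :: r) g j y) = g i + (fun y => \sum_(j <- r) g j y).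
  by apply/funext => y; rewrite big_cons.
by rewrite !E; exact: is_diffD.
Qed.

(** [(submxrow 1%:M i)^T] is the injection of block [i]. Concatenation becomes a sum of linear maps,
    to which the sum and composition rules of differentiation apply. *)
Lemma mxrowE_sum J (q : 'I_J -> nat) k (B : forall i, 'M[R]_(k, q i)) :
  \mxrow_i B i = \sum_i B i *m (submxrow 1%:M i)^T.
Proof.
rewrite -[LHS]mulmx1 -[1%:M in LHS]trmx1 -[1%:M in LHS]submxrowK tr_mxrow.
exact: mul_mxrow_mxcol.
Qed.

Lemma C1_mxrow J (q : 'I_J -> nat) (f : forall i, 'rV[R]_n -> 'rV[R]_(q i)) :
  (forall i, continuously_differentiable (f i)) ->
  continuously_differentiable (fun z => \mxrow_i f i z) /\
  forall z, 'J (fun z => \mxrow_i f i z) z = \mxrow_i 'J (f i) z.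
Proof.
move=> fC1; have dmxrow z : is_diff z (fun y => \mxrow_i f i y)
    (fun v => v *m \mxrow_i 'J (f i) z).
  rewrite (funext (fun y => mxrowE_sum (fun i => f i y))).
  rewrite (_ : mulmx^~ _ =
      fun v => \sum_i (v *m 'J (f i) z) *m (submxrow 1%:M i)^T); last first.
    by apply/funext => v; rewrite mul_mxrow mxrowE_sum.
  apply: is_diff_bigsum => i; apply: is_diff_mulmxr.
  by apply: is_diff_jacobian; exact: (fC1 i).1.
have JE z := jacobian_is_diff (dmxrow z).
split=> //; split=> [z|]; first exact: ex_diff.
rewrite (_ : (fun z => _) = fun z => \mxrow_i 'J (f i) z); last exact/funext.
move=> z; have cJ i j : (\mxrow_k 'J (f k) y) i j @[y --> (z : 'rV[R]_n)] -->
    (\mxrow_k 'J (f k) z) i j.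
  under eq_fun do rewrite mxE; rewrite mxE.
  exact: (cvg_coord ((fC1 _).2 z)).
exact: (cvg_mx cJ).
Qed.

Lemma C1_row_mx m k (f : 'rV[R]_n -> 'rV[R]_m) (g : 'rV[R]_n -> 'rV[R]_k) :
  continuously_differentiable f -> continuously_differentiable g ->
  continuously_differentiable (fun z => row_mx (f z) (g z)) /\
  forall z, 'J (fun z => row_mx (f z) (g z)) z = row_mx ('J f z) ('J g z).
Proof.
move=> [fd fc] [gd gc].
(* [row_mx 1%:M 0] and [row_mx 0 1%:M] are the two block injections. *)
have row_mxE h (a : 'M[R]_(h, m)) (b : 'M[R]_(h, k)) :
    row_mx a b = a *m row_mx 1%:M 0 + b *m row_mx 0 1%:M.
  by rewrite !mul_mx_row !mulmx1 !mulmx0 add_row_mx addr0 add0r.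
have drow z : is_diff z (fun y => row_mx (f y) (g y))
    (fun v => v *m row_mx ('J f z) ('J g z)).
  rewrite (funext (fun y => row_mxE _ (f y) (g y))).
  rewrite (_ : mulmx^~ _ = fun v => v *m 'J f z *m row_mx 1%:M 0
      + v *m 'J g z *m row_mx 0 1%:M); last first.
    by apply/funext => v; rewrite mul_mx_row row_mxE.
  by apply: is_diffD; apply: is_diff_mulmxr; exact: is_diff_jacobian.
have JE z := jacobian_is_diff (drow z).
have cJ (z : 'rV[R]_n) i j : (row_mx ('J f y) ('J g y)) i j @[y --> z] -->
    (row_mx ('J f z) ('J g z)) i j.
  under eq_fun do rewrite mxE; rewrite mxE.
  case: (fintype.split j) => j'; first exact: (cvg_coord (fc z)).
  exact: (cvg_coord (gc z)).
split=> //; split=> [z|]; first exact: ex_diff.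
rewrite (_ : (fun z => _) = fun z => row_mx ('J f z) ('J g z)).
  by move=> z; exact: (cvg_mx (cJ z)).
exact/funext.
Qed.

(** Turns the kernel condition on one stacked multiplier into the sum that appears in [NNAMCQ]. *)
Lemma mul_tr_block_row N J (p q : 'I_J -> nat) (a : 'rV[R]_N)
    (b : forall i, 'rV[R]_(p i)) (c : forall i, 'rV[R]_(q i))
    (A : 'M[R]_(n, N)) (B : forall i, 'M[R]_(n, p i))
    (C : forall i, 'M[R]_(n, q i)) :
  row_mx a (row_mx (\mxrow_i b i) (\mxrow_i c i)) *m
    (row_mx A (row_mx (\mxrow_i B i) (\mxrow_i C i)))^T =
  a *m A^T + \sum_i (b i *m (B i)^T + c i *m (C i)^T).
Proof.
by rewrite !tr_row_mx !mul_row_col !tr_mxrow !mul_mxrow_mxcol big_split.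
Qed.

End block_jacobian.

(** * Cartesian products: closedness, normal cones and norms *)

Section product_sets.
Set Implicit Arguments.
Unset Strict Implicit.
Variable R : realType.
Implicit Types N M J : nat.

Lemma lsubmx_continuous h N M :
  continuous (lsubmx : 'M[R]_(h, N + M) -> 'M[R]_(h, N)).
Proof.
move=> x; have cx i j :
    (lsubmx y) i j @[y --> (x : 'M[R]_(h, N + M))] --> (lsubmx x) i j.
  under eq_fun do rewrite mxE; rewrite mxE; exact: coord_continuous.
exact: (cvg_mx cx).
Qed.

Lemma rsubmx_continuous h N M :
  continuous (rsubmx : 'M[R]_(h, N + M) -> 'M[R]_(h, M)).
Proof.
move=> x; have cx i j :
    (rsubmx y) i j @[y --> (x : 'M[R]_(h, N + M))] --> (rsubmx x) i j.
  under eq_fun do rewrite mxE; rewrite mxE; exact: coord_continuous.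
exact: (cvg_mx cx).
Qed.

Definition row_mx_set N M (A : set 'rV[R]_N) (B : set 'rV[R]_M) :
  set 'rV[R]_(N + M) := [set w | A (lsubmx w) /\ B (rsubmx w)].

Lemma closed_row_mx_set N M (A : set 'rV[R]_N) (B : set 'rV[R]_M) :
  closed A -> closed B -> closed (row_mx_set A B).
Proof.
move=> cA cB.
rewrite (_ : row_mx_set A B = lsubmx @^-1` A `&` rsubmx @^-1` B)//.
apply: closedI; apply: preimage_closed => // x _.
  exact: lsubmx_continuous.
exact: rsubmx_continuous.
Qed.

Lemma enorm_row_mx0 N M (a : 'rV[R]_N) : enorm (row_mx a (0 : 'rV_M)) = enorm a.
Proof. by rewrite /enorm dot_row_mx dot0r addr0. Qed.

Lemma enorm_row_0mx N M (b : 'rV[R]_M) : enorm (row_mx (0 : 'rV_N) b) = enorm b.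
Proof. by rewrite /enorm dot_row_mx dot0r add0r. Qed.

(** The defining inequality is tested only at points that differ from [w] in one block; the other
    block of [w] stays in its factor. *)
Lemma regular_normal_row_mx N M (A : set 'rV[R]_N) (B : set 'rV[R]_M) w v :
  row_mx_set A B w -> regular_normal (row_mx_set A B) w v ->
  regular_normal A (lsubmx w) (lsubmx v) /\
  regular_normal B (rsubmx w) (rsubmx v).
Proof.
move=> [Aw Bw] vn.
have dotl a : dot v (row_mx a 0) = dot (lsubmx v) a.
  by rewrite -[in LHS](hsubmxK v) dot_row_mx dot0r addr0.
have dotr b : dot v (row_mx 0 b) = dot (rsubmx v) b.
  by rewrite -[in LHS](hsubmxK v) dot_row_mx dot0r add0r.
have subl a : row_mx a (rsubmx w) - w = row_mx (a - lsubmx w) 0.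
  by rewrite -[w in _ - w]hsubmxK opp_row_mx add_row_mx subrr.
have subr b : row_mx (lsubmx w) b - w = row_mx 0 (b - rsubmx w).
  by rewrite -[w in _ - w]hsubmxK opp_row_mx add_row_mx subrr.
split=> e e0; have [d d0 dP] := enorm_near (vn e e0).
  have := near_enorm (lsubmx w) d0; apply: filterS => a ad Aa.
  have := dP (row_mx a (rsubmx w)); rewrite subl enorm_row_mx0 dotl.
  by apply => //; rewrite /row_mx_set /= row_mxKl row_mxKr.
have := near_enorm (rsubmx w) d0; apply: filterS => b bd Bb.
have := dP (row_mx (lsubmx w) b); rewrite subr enorm_row_0mx dotr.
by apply => //; rewrite /row_mx_set /= row_mxKl row_mxKr.
Qed.

(** The block projections are continuous, so the approximating sequences can be projected. *)
Lemma limiting_normal_row_mx N M (A : set 'rV[R]_N) (B : set 'rV[R]_M) w v :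
  limiting_normal (row_mx_set A B) w v ->
  limiting_normal A (lsubmx w) (lsubmx v) /\
  limiting_normal B (rsubmx w) (rsubmx v).
Proof.
move=> [zk [vk [ABz vn zw vv]]]; split.
  exists (lsubmx \o zk), (lsubmx \o vk); split=> [k|k||].
  - exact: (ABz k).1.
  - exact: (regular_normal_row_mx (ABz k) (vn k)).1.
  - exact: (cvg_comp _ _ zw (@lsubmx_continuous _ _ _ _)).
  - exact: (cvg_comp _ _ vv (@lsubmx_continuous _ _ _ _)).
exists (rsubmx \o zk), (rsubmx \o vk); split=> [k|k||].
- exact: (ABz k).2.
- exact: (regular_normal_row_mx (ABz k) (vn k)).2.
- exact: (cvg_comp _ _ zw (@rsubmx_continuous _ _ _ _)).
- exact: (cvg_comp _ _ vv (@rsubmx_continuous _ _ _ _)).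
Qed.

Lemma enorm_row_mx_le N M (a : 'rV[R]_N) (b : 'rV[R]_M) :
  enorm (row_mx a b) <= enorm a + enorm b.
Proof.
rewrite -(ler_pXn2r (n := 2))// ?nnegrE ?addr_ge0 ?enorm_ge0//.
rewrite sqr_enorm dot_row_mx sqrrD !sqr_enorm addrAC lerDl mulrn_wge0//.
by rewrite mulr_ge0 ?enorm_ge0.
Qed.

Lemma enorm_mxrow_le J (p q : 'I_J -> nat) (a : forall i, 'rV[R]_(p i))
    (b : forall i, 'rV[R]_(q i)) :
  enorm (row_mx (\mxrow_i a i) (\mxrow_i b i)) <=
  \sum_i enorm (row_mx (a i) (b i)).
Proof.
rewrite -(ler_pXn2r (n := 2))// ?nnegrE ?enorm_ge0 ?sumr_ge0//; last first.
  by move=> i _; exact: enorm_ge0.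
rewrite sqr_enorm dot_row_mx !dot_mxrow -big_split /=.
under eq_bigr do rewrite -dot_row_mx -sqr_enorm.
suff [] : 0 <= \sum_i enorm (row_mx (a i) (b i)) /\
  \sum_i enorm (row_mx (a i) (b i)) ^+ 2 <=
  (\sum_i enorm (row_mx (a i) (b i))) ^+ 2 by [].
elim/big_ind2: _ => [|s x t y [x0 sx] [y0 ty]|i _].
- by rewrite expr0n.
- split; first exact: addr_ge0.
  by rewrite sqrrD; have := mulr_ge0 x0 y0; lra.
- by rewrite enorm_ge0.
Qed.

End product_sets.

(** * Second-order cones and their complementarity sets *)

Section second_order_cone.
Set Implicit Arguments.
Unset Strict Implicit.
Variable R : realType.

Lemma closed_soc p : closed (soc R p).
Proof.
rewrite (_ : soc R p = (fun x : 'rV[R]_p.+1 => x 0 ord0 - enorm (col' ord0 x))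
    @^-1` [set r | 0 <= r]); last first.
  by apply/seteqP; split => x; rewrite /soc /= subr_ge0.
apply: preimage_closed => [x _|]; last exact: closed_ge.
have cx : col' ord0 y @[y --> x] --> col' ord0 x.
  suff c i j :
      (col' ord0 y) i j @[y --> (x : 'rV[R]_p.+1)] --> (col' ord0 x) i j.
    exact: (cvg_mx c).
  under eq_fun do rewrite mxE; rewrite mxE; exact: coord_continuous.
exact: (cvgB (@coord_continuous _ _ _ 0 ord0 x) (cvg_enorm cx)).
Qed.

Lemma closed_soc_prod J (p : 'I_J -> nat) : closed (soc_prod R p).
Proof.
rewrite (_ : soc_prod R p =
    \bigcap_i ((fun x => submxrow x i) @^-1` soc R (p i))); last first.
  by apply/seteqP; split => [x xK i _|x xK i]; exact: xK.
apply: closed_bigI => i _.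
apply: preimage_closed => [x _|]; last exact: closed_soc.
suff c k j : (submxrow y i) k j @[y --> (x : 'rV[R]_(\sum_i (p i).+1))] -->
    (submxrow x i) k j by exact: (cvg_mx c).
have E (y : 'rV[R]_(\sum_i (p i).+1)) :
    (submxrow y i) k j = y k (tagnat.Rank i j) by rewrite mxE.
rewrite E (funext E); exact: coord_continuous.
Qed.

Lemma closed_Omega N (K : set 'rV[R]_N) : closed K -> closed (Omega K).
Proof.
move=> cK; rewrite (_ : Omega K = row_mx_set K K `&`
    (fun w => dot (lsubmx w) (rsubmx w)) @^-1` [set r | r = 0]).
  apply: closedI; first exact: closed_row_mx_set.
  apply: preimage_closed => [w _|]; last exact: closed_eq.
  exact: (cvg_dot (@lsubmx_continuous _ _ _ _ w)
    (@rsubmx_continuous _ _ _ _ w)).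
by apply/seteqP; split => w; [case|case=> -[]].
Qed.

(** By Cauchy-Schwarz, [- dot x_2 y_2 <= |x_2| |y_2| <= x_1 y_1]. *)
Lemma soc_dot_ge0 p (x y : 'rV[R]_p.+1) :
  soc R p x -> soc R p y -> 0 <= dot x y.
Proof.
rewrite /soc /= => x0 y0.
have -> : dot x y = x 0 ord0 * y 0 ord0 + dot (col' ord0 x) (col' ord0 y).
  rewrite /dot big_ord_recl; congr (_ + _); apply: eq_bigr => j _.
  by rewrite !mxE.
have := cauchy_schwarz (- col' ord0 x) (col' ord0 y); rewrite dotNl enormN.
have := ler_pM (enorm_ge0 _) (enorm_ge0 _) x0 y0; lra.
Qed.

(** The blockwise products are nonnegative on the cones, so a zero sum makes each of them zero. *)
Lemma complementary_soc_prod J (p : 'I_J -> nat)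
    (x y : forall i, 'rV[R]_(p i).+1) :
  complementary (soc_prod R p) (\mxrow_i x i) (\mxrow_i y i) <->
  forall i, complementary (soc R (p i)) (x i) (y i).
Proof.
rewrite /complementary dot_mxrow /soc_prod /=; split.
  move=> [Kx Ky xy0] i.
  have {}Kx j : soc R (p j) (x j) by have := Kx j; rewrite mxrowK.
  have {}Ky j : soc R (p j) (y j) by have := Ky j; rewrite mxrowK.
  split=> //; apply: (psumr_eq0P _ xy0) => // j _.
  exact: soc_dot_ge0.
move=> Kxy; split=> [i|i|]; rewrite ?mxrowK; try by have [] := Kxy i.
by rewrite big1// => i _; have [] := Kxy i.
Qed.

(** Nearest points in the factors concatenate to a point of the product, and the norm of a
    concatenation is at most the sum of the norms of its blocks. *)
Lemma dist_row_mx_set_le N J (p : 'I_J -> nat) (A : set 'rV[R]_N) a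
    (x y : forall i, 'rV[R]_(p i).+1) :
  closed A -> A !=set0 ->
  dist (row_mx_set A (Omega (soc_prod R p)))
    (row_mx a (row_mx (\mxrow_i x i) (\mxrow_i y i))) <=
  dist A a + \sum_i dist (Omega (soc R (p i))) (row_mx (x i) (y i)).
Proof.
move=> Acl A0; have [c Ac ->] := dist_attained a Acl A0.
have wx (i : 'I_J) : exists w, Omega (soc R (p i)) w /\
    dist (Omega (soc R (p i))) (row_mx (x i) (y i)) =
    enorm (row_mx (x i) (y i) - w).
  have [||w ? ?] := dist_attained (C := Omega (soc R (p i)))
    (row_mx (x i) (y i)).
  - exact/closed_Omega/closed_soc.
  (* The zero pair is complementary, so the factor is nonempty and its distance is attained. *)
  - exists 0; rewrite /Omega /= !linear0 /complementary dot0r /soc /=.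
    by rewrite linear0 enorm0 mxE.
  - by exists w.
(* The type of [w i] depends on [i], so the witnesses are picked one by one with [cid]. *)
have [w wP] : exists w : forall i, 'rV[R]_((p i).+1 + (p i).+1), forall i,
    Omega (soc R (p i)) (w i) /\
    dist (Omega (soc R (p i))) (row_mx (x i) (y i)) =
    enorm (row_mx (x i) (y i) - w i).
  by exists (fun i => sval (cid (wx i))) => i; exact: (svalP (cid (wx i))).
(* Regroups the pairs [(x_i, y_i)] as one pair of stacked vectors. *)
pose w' := row_mx (\mxrow_i lsubmx (w i)) (\mxrow_i rsubmx (w i)).
apply: (@le_trans _ _ (enorm
    (row_mx a (row_mx (\mxrow_i x i) (\mxrow_i y i)) - row_mx c w'))).
  apply: dist_le; rewrite /row_mx_set /Omega /w' /= !(row_mxKl, row_mxKr).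
  split=> //; apply/complementary_soc_prod => i.
  exact: (wP i).1.
rewrite opp_row_mx add_row_mx (le_trans (enorm_row_mx_le _ _))// lerD2l.
rewrite opp_row_mx add_row_mx -!mxrowB (le_trans (enorm_mxrow_le _ _))//.
apply: ler_sum => i _; rewrite (wP i).2 -{3}(hsubmxK (w i)).
by rewrite opp_row_mx add_row_mx.
Qed.

End second_order_cone.

(** * The complementarity system as one inclusion *)

Theorem theorem7p1 (R : realType) (n l J : nat) (p : 'I_J -> nat)
  (Lambda : set 'rV[R]_l) (F : 'rV[R]_n -> 'rV[R]_l)
  (G H : forall i : 'I_J, 'rV[R]_n -> 'rV[R]_(p i).+1)
  (Lambda_closed : closed Lambda)
  (F_C1 : continuously_differentiable F)
  (G_C1 : forall i, continuously_differentiable (G i))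
  (H_C1 : forall i, continuously_differentiable (H i))
  (zs : 'rV[R]_n) (zs_feasible : feasible Lambda F G H zs)
  (zs_NNAMCQ : NNAMCQ Lambda F G H zs) :
  local_error_bound Lambda F G H zs.
Proof.
have [GJ_C1 GJ_J] := C1_mxrow G_C1; have [HJ_C1 HJ_J] := C1_mxrow H_C1.
have [GH_C1 GH_J] := C1_row_mx GJ_C1 HJ_C1.
have [Phi_C1 Phi_J] := C1_row_mx F_C1 GH_C1.
set Phi := fun z => row_mx (F z) _ in Phi_C1 Phi_J.
pose D := row_mx_set Lambda (Omega (soc_prod R p)).
have D_closed : closed D.
  exact/(closed_row_mx_set Lambda_closed)/closed_Omega/closed_soc_prod.
have feasibleE : feasible Lambda F G H = Phi @^-1` D.
  apply/seteqP; split=> z; rewrite /D /Phi /feasible /row_mx_set /Omega /=;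
    by rewrite !(row_mxKl, row_mxKr) => -[].
have zs_sol : D (Phi zs) by move: zs_feasible; rewrite feasibleE.
have [u uJ uN|kappa kappa0 bound] :=
  error_bound_of_qualification D_closed Phi_C1 zs_sol.
  have [uF uGH] := limiting_normal_row_mx uN.
  rewrite /Phi row_mxKl in uF; rewrite /Phi row_mxKr in uGH.
  pose uG := lsubmx (rsubmx u); pose uH := rsubmx (rsubmx u).
  (* Every vector [u] is a stacked multiplier, which allows [NNAMCQ] to be applied to its blocks. *)
  have uE : u = row_mx (lsubmx u)
      (row_mx (\mxrow_i submxrow uG i) (\mxrow_i submxrow uH i)).
    by rewrite !submxrowK !hsubmxK.
  have [|//||uF0 uG0 uH0] := zs_NNAMCQ (lsubmx u) (submxrow uG) (submxrow uH).
  - move: uJ; rewrite [X in X *m _]uE Phi_J GH_J GJ_J HJ_J.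
    by rewrite mul_tr_block_row.
  - by rewrite !submxrowK hsubmxK.
  rewrite uE uF0 (eq_mxrow uG0) (eq_mxrow uH0) !mxrow0.
  by rewrite !row_mx0.
exists kappa => //; rewrite feasibleE; apply: filterS bound => z.
move=> /le_trans; apply.
rewrite ler_pM2l//; apply: dist_row_mx_set_le => //.
by exists (F zs); case: zs_feasible.
Qed.
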